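(* Let $m\ge 1$ and $n\ge 1$ be integers. For $0\le s\le m$ define $$Q_{m,s}(q)=\frac{\prod_{j=0}^{s}(1-q^{2m-2j+1})}{(1-q)^{s}(1-q^2)^{2s}}\sum_{k=0}^{s}\frac{(-1)^{s-k}}{1-q^{2m-2k+1}}\left[\binom{2m-1}{k}-\binom{2m-1}{k-2}\right]\sum_{i=0}^{s-k}\binom{m-s+i}{i}\left[\binom{m-k-i}{s-k-i}q^{2s-2k-2i}+\binom{m-k-i-1}{s-k-i-1}q^{2s-2k-2i-1}\right].$$ Then each $Q_{m,s}(q)$ is a polynomial in $\mathbb{Z}[q]$, and $$S_{2m,n}(q)=\sum_{k=0}^{m}(-1)^kQ_{m,k}(q^{1/2})\frac{(1-q^{n+\frac12})(1-q^n)^{m-k}(1-q^{n+1})^{m-k}(1-q^{1/2})^kq^{kn}}{(1-q^2)(1-q)^{2m-2k-1}\prod_{i=0}^{k}(1-q^{m-i+\frac12})}.$$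
   Context: $q$ is an indeterminate and $q^{1/2}$ a fixed formal square root of $q$; identities are identities of rational functions in $q^{1/2}$. For integers $m,n\ge1$, $$S_{m,n}(q)=\sum_{k=1}^{n}\frac{1-q^{2k}}{1-q^2}\left(\frac{1-q^k}{1-q}\right)^{m-1}q^{\frac{m+1}{2}(n-k)}.$$ Binomial coefficients $\binom{a}{b}$ with integers $a,b$ are taken to be $0$ when $b<0$ or when $0\le a<b$. *)

(* Defs.v *)
(* Rational functions in the indeterminate t = q^{1/2}
   live in the fraction field {fraction {poly int}}. *)
From mathcomp Require Import all_boot all_algebra fraction.
Set Implicit Arguments. Unset Strict Implicit. Unset Printing Implicit Defensive.
Import GRing.Theory Num.Theory.
Local Open Scope ring_scope.

(* Integer binomial: 0 when b < 0 or 0 <= a < b (the latter is automatic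
   for 'C); the case a < 0 <= b never occurs in the statement. *)
Definition binz (a b : int) : int :=
  if (b < 0) || (a < 0) then 0 else ('C(`|a|%N, `|b|%N))%:Z.

Definition Qms (F : fieldType) (m s : nat) (x : F) : F :=
  (\prod_(0 <= j < s.+1) (1 - x ^ (2 * m%:Z - 2 * j%:Z + 1)))
  / ((1 - x) ^+ s * (1 - x ^+ 2) ^+ (2 * s))
  * \sum_(0 <= k < s.+1)
      ((-1) ^ (s%:Z - k%:Z) / (1 - x ^ (2 * m%:Z - 2 * k%:Z + 1))
       * (binz (2 * m%:Z - 1) k%:Z - binz (2 * m%:Z - 1) (k%:Z - 2))%:~R
       * \sum_(0 <= i < (s - k).+1)
           ((binz (m%:Z - s%:Z + i%:Z) i%:Z)%:~R
            * ((binz (m%:Z - k%:Z - i%:Z) (s%:Z - k%:Z - i%:Z))%:~R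
                 * x ^ (2 * s%:Z - 2 * k%:Z - 2 * i%:Z)
               + (binz (m%:Z - k%:Z - i%:Z - 1) (s%:Z - k%:Z - i%:Z - 1))%:~R
                 * x ^ (2 * s%:Z - 2 * k%:Z - 2 * i%:Z - 1)))).

(* S_{m,n}(q) written in t = q^{1/2}: q^{(m+1)(n-k)/2} = t^{(m+1)(n-k)}. *)
Definition Smn (F : fieldType) (m n : nat) (t : F) : F :=
  \sum_(1 <= k < n.+1)
    ((1 - t ^+ (4 * k)) / (1 - t ^+ 4)
     * ((1 - t ^+ (2 * k)) / (1 - t ^+ 2)) ^+ (m - 1)
     * t ^+ ((m + 1) * (n - k))).

Definition rhs12 (F : fieldType) (m n : nat) (t : F) : F :=
  \sum_(0 <= k < m.+1)
    ((-1) ^+ k * Qms m k t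
     * ((1 - t ^+ (2 * n + 1)) * (1 - t ^+ (2 * n)) ^+ (m - k)
        * (1 - t ^+ (2 * n + 2)) ^+ (m - k) * (1 - t) ^+ k * t ^+ (2 * k * n))
     / ((1 - t ^+ 4) * (1 - t ^+ 2) ^ (2 * m%:Z - 2 * k%:Z - 1)
        * \prod_(0 <= i < k.+1) (1 - t ^+ (2 * m - 2 * i + 1)))).

Definition tX : {fraction {poly int}} := FracField.tofrac ('X : {poly int}).

(* Main.v *)
Require Import Defs.
From mathcomp Require Import all_boot all_algebra fraction.
From mathcomp Require Import zify ring.
Import GRing.Theory Num.Theory.
Local Open Scope ring_scope.

(** Write q = t^2, x = t^k, and g(x) = (x - 1/x)^(2m-1) (x^2 - 1/x^2).  Up to a
    monomial and a constant denominator, S_{2m,n} is the sum of g(t^k) for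
    k <= n.  As g is invariant under x -> 1/x, it is a combination of the
    x^r + x^-r with r = 2(m-k)+1 and coefficients
    (-1)^k (binom(2m-1,k) - binom(2m-1,k-2)), so its sum is a combination of the
    (1 - Z^r)/(1 - t^r), where Z = t^(2n+1).  Each (1 - Z^r)/(1 - Z) is then
    expanded in powers of
      W_n = t(Z + 1/Z) - t^2 - 1 = t^(-2n) (1 - t^(2n)) (1 - t^(2n+2)),
    the coefficient of W^p being that of X^(m-k-p) in
    (1 + tX) / ((1 - X)(1 - t^2 X))^(p+1); this gives the closed form.

    For integrality, the closed form says that a polynomial of degree at most m,
    whose coefficients are the Q_{m,s} up to units at t = 1 and t = -1, takes at
    the points W_n/(1 - t^2)^2 values that are regular at t = 1 and t = -1.
    For n = 0, ..., m the differences of these points are units there, so by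
    interpolation every Q_{m,s} is regular at t = 1 and t = -1.  Its
    denominator is a power of 1 - t times a power of 1 + t, hence it divides the
    numerator, already over the integers. *)

(** * Coefficients of (1 + tX) / ((1 - X)(1 - t^2 X))^(p+1) *)

Section Shift.
Context {R : comNzRingType}.
Implicit Types (f g : nat -> R) (c w : R).

(** Sequences stand for formal power series in X: [shift] is multiplication by X and [conv] is the
    product. *)
Definition shift f (j : nat) : R := if j is j'.+1 then f j' else 0.

Definition conv f g (j : nat) : R := \sum_(i < j.+1) f i * g (j - i)%N.

Lemma conv_recl f f' g c :
  (forall j, f j = c * shift f j + f' j) ->
  forall j, conv f g j = c * shift (conv f g) j + conv f' g j.
Proof.
move=> Df j; rewrite /conv.
under eq_bigr => i _ do rewrite Df mulrDl.
rewrite big_split /=; congr (_ + _).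
case: j => [|j] /=; first by rewrite big_ord1 /= !(mulr0, mul0r).
rewrite big_ord_recl /= mulr0 mul0r add0r mulr_sumr.
by apply: eq_bigr => i _; rewrite /= mulrA.
Qed.

Lemma convC f g j : conv f g j = conv g f j.
Proof.
rewrite /conv (reindex_inj rev_ord_inj) /=; apply: eq_bigr => i _.
by rewrite subSS subKn ?leq_ord // mulrC.
Qed.

Lemma conv_recr f g g' c :
  (forall j, g j = c * shift g j + g' j) ->
  forall j, conv f g j = c * shift (conv f g) j + conv f g' j.
Proof.
move=> Dg j; rewrite convC (conv_recl _ _ _ _ Dg) convC.
by case: j => [|j] //=; rewrite convC.
Qed.

Lemma conv_shiftr f g j :
  conv f (shift g) j = shift (conv f g) j.
Proof.
rewrite /conv; case: j => [|j]; first by rewrite big_ord1 /= mulr0.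
rewrite big_ord_recr /= subnn /= mulr0 addr0; apply: eq_bigr => i _.
by rewrite subSn // -ltnS.
Qed.

Lemma shift_ext f g : f =1 g -> shift f =1 shift g.
Proof. by move=> fg [|j] /=. Qed.

Lemma shift_sum_diag (f : nat -> nat -> R) w M :
  shift (fun M => \sum_(p < M.+1) f p (M - p)%N * w ^+ p) M
  = \sum_(p < M.+1) shift (f p) (M - p)%N * w ^+ p.
Proof.
case: M => [|M] /=; first by rewrite big_ord1 mul0r.
rewrite [RHS]big_ord_recr /= subnn /= mul0r addr0.
by apply: eq_bigr => i _; rewrite subSn // -ltnS.
Qed.

(* [hcoef c p j] and [bcoef y p j] are the coefficients of X^j in
   1/(1 - cX)^p and in 1/((1 - X)(1 - yX))^p. *)
Definition hcoef c (p j : nat) : R := 'C((p + j).-1, j)%:R * c ^+ j.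

Definition bcoef y (p : nat) := conv (hcoef 1 p) (hcoef y p).

Lemma hcoef_rec c p j :
  hcoef c p.+1 j = c * shift (hcoef c p.+1) j + hcoef c p j.
Proof.
rewrite /hcoef; case: j => [|j] /=; first by rewrite !bin0 mulr0 add0r.
by rewrite !addnS ?addSn /= binS natrD exprS; ring.
Qed.

(** The truncated predecessor in [hcoef] is harmless at p = 0: it gives the coefficients of the
    series 1. *)
Lemma hcoef0 c j : hcoef c 0 j = (j == 0%N)%:R.
Proof.
rewrite /hcoef; case: j => [|j]; first by rewrite bin0 mul1r.
by rewrite add0n bin_small // mul0r.
Qed.

Lemma bcoef0 y j : bcoef y 0 j = (j == 0%N)%:R.
Proof.
rewrite /bcoef /conv big_ord_recl !hcoef0 /= mul1r subn0 big1 ?addr0 // => i _.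
by rewrite hcoef0 mul0r.
Qed.

(** Multiplying by (1 - X)(1 - yX) lowers the exponent p + 1 by one; the two factors are removed in
    turn, with [c] the series in between. *)
Lemma bcoef_rec y p j :
  bcoef y p.+1 j = (1 + y) * shift (bcoef y p.+1) j
    - y * shift (shift (bcoef y p.+1)) j + bcoef y p j.
Proof.
set c := conv (hcoef 1 p) (hcoef y p.+1).
have E1 i : bcoef y p.+1 i = shift (bcoef y p.+1) i + c i.
  by rewrite {1}/bcoef (conv_recl _ _ _ _ (hcoef_rec _ _)) mul1r.
have E2 i : c i = y * shift c i + bcoef y p i.
  by rewrite /c (conv_recr _ _ _ _ (hcoef_rec _ _)).
have E3 i : c i = bcoef y p.+1 i - shift (bcoef y p.+1) i by rewrite E1; ring.
rewrite E1 E2; case: j => [|j] /=; first by ring.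
by rewrite E3; ring.
Qed.

(** Coefficient of X^M in the sum over p of (wX)^p / ((1 - X)(1 - yX))^(p+1), a geometric series
    equal to 1 / (1 - (1 + y + w)X + yX^2). Hence the recurrence [bsum_rec]. *)
Definition bsum y w M := \sum_(p < M.+1) bcoef y p.+1 (M - p)%N * w ^+ p.

Lemma shift_bsum y w : shift (bsum y w) =1
  fun M => \sum_(p < M.+1) shift (bcoef y p.+1) (M - p)%N * w ^+ p.
Proof. exact: (shift_sum_diag (fun p => bcoef y p.+1)). Qed.

Lemma bsum_rec y w M :
  bsum y w M = (1 + y + w) * shift (bsum y w) M
    - y * shift (shift (bsum y w)) M + (M == 0%N)%:R.
Proof.
have S2 k : shift (shift (bsum y w)) k =
    \sum_(p < k.+1) shift (shift (bcoef y p.+1)) (k - p)%N * w ^+ p.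
  rewrite (shift_ext _ _ (shift_bsum y w)).
  exact: (shift_sum_diag (fun p => shift (bcoef y p.+1))).
have -> : bsum y w M = (1 + y) * shift (bsum y w) M
    - y * shift (shift (bsum y w)) M
    + \sum_(p < M.+1) bcoef y p (M - p)%N * w ^+ p.
  rewrite S2 shift_bsum !mulr_sumr -sumrB -big_split /=; apply: eq_bigr => p _.
  by rewrite bcoef_rec; ring.
(* The term p = 0 is the series 1; the others are wX times the whole sum. *)
rewrite big_ord_recl bcoef0 subn0 expr0 mulr1.
suff -> : \sum_(i < M) bcoef y (lift ord0 i) (M - lift ord0 i)%N
    * w ^+ (lift ord0 i) = w * shift (bsum y w) M by ring.
case: M => [|M]; first by rewrite big_ord0 mulr0.
rewrite /= mulr_sumr; apply: eq_bigr => i _ /=.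
by rewrite /bump /= subSS exprS; ring.
Qed.

Definition acoef t p j : R := bcoef (t ^+ 2) p.+1 j
  + t * shift (bcoef (t ^+ 2) p.+1) j.

Definition asum t w M := \sum_(p < M.+1) acoef t p (M - p)%N * w ^+ p.

Lemma asumE t w M :
  asum t w M = bsum (t ^+ 2) w M + t * shift (bsum (t ^+ 2) w) M.
Proof.
rewrite shift_bsum mulr_sumr -big_split /=.
by apply: eq_bigr => p _; rewrite /acoef; ring.
Qed.

Lemma asum0 t w : asum t w 0 = 1.
Proof. by rewrite asumE bsum_rec /=; ring. Qed.

Lemma asum1 t w : asum t w 1 = 1 + t + t ^+ 2 + w.
Proof. by rewrite asumE bsum_rec /= bsum_rec /=; ring. Qed.

(** The numerator 1 + tX only affects the coefficients of index 0 and 1, so from index 2 on the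
    recurrence is homogeneous. *)
Lemma asum_rec t w M : asum t w M.+2
  = (1 + t ^+ 2 + w) * asum t w M.+1 - t ^+ 2 * asum t w M.
Proof.
by rewrite !asumE bsum_rec /= [X in _ + t * X]bsum_rec /=; ring.
Qed.

End Shift.

(** For this w the characteristic polynomial of [asum_rec] is X^2 - t(z + 1/z)X + t^2, with roots tz
    and t/z. The induction carries two consecutive indices. *)
Lemma asum_geometric (F : fieldType) (t z : F) M : z != 0 ->
  asum t (t * (z + z^-1) - t ^+ 2 - 1) M * (1 - z) * z ^+ M
  = t ^+ M * (1 - z ^+ (2 * M + 1)).
Proof.
move=> z0; set w := t * _ - _ - _.
have [-> //] : asum t w M * (1 - z) * z ^+ M
    = t ^+ M * (1 - z ^+ (2 * M + 1))
  /\ asum t w M.+1 * (1 - z) * z ^+ M.+1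
    = t ^+ M.+1 * (1 - z ^+ (2 * M.+1 + 1)).
elim: M => [|M [IH1 IH2]].
  by rewrite asum0 asum1 /w; split; field.
split=> //.
rewrite asum_rec.
have -> : ((1 + t ^+ 2 + w) * asum t w M.+1 - t ^+ 2 * asum t w M)
    * (1 - z) * z ^+ M.+2 = z * (1 + t ^+ 2 + w) *
      (asum t w M.+1 * (1 - z) * z ^+ M.+1)
    - t ^+ 2 * z ^+ 2 * (asum t w M * (1 - z) * z ^+ M).
  by rewrite !exprS; ring.
rewrite IH1 IH2.
have -> : (2 * M.+2 + 1 = (2 * M + 1).+4)%N by lia.
have -> : (2 * M.+1 + 1 = (2 * M + 1).+2)%N by lia.
by rewrite /w !exprS; field.
Qed.

(** * Closed form of the power sums *)

(** Up to the sign (-1)^k, the coefficient of X^k in (1 - X)^N (1 - X^2). The double [shift] encodes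
    the index k - 2, with value 0 for k < 2. *)
Definition dcoef (N k : nat) : int :=
  'C(N, k)%:Z - shift (shift (fun j => 'C(N, j)%:Z)) k.

Lemma dcoefR (R : comNzRingType) N k : (dcoef N k)%:~R
  = 'C(N, k)%:R - shift (shift (fun j => 'C(N, j)%:R)) k :> R.
Proof. by rewrite /dcoef rmorphB; case: k => [|[|k]]. Qed.

Lemma dcoef_gen (R : comNzRingType) (u : R) N :
  (u - 1) ^+ N * (u ^+ 2 - 1)
  = \sum_(k < N.+3) (-1) ^+ k * (dcoef N k)%:~R * u ^+ (N.+2 - k).
Proof.
have uN : (u - 1) ^+ N = \sum_(k < N.+1) (-1) ^+ k * 'C(N, k)%:R * u ^+ (N - k).
  rewrite exprBn; apply: eq_bigr => k _.
  by rewrite expr1n mulr1 -mulr_natr; ring.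
transitivity (u ^+ 2 * (u - 1) ^+ N - (u - 1) ^+ N); first by ring.
under [RHS]eq_bigr => k _ do rewrite dcoefR mulrBr mulrBl.
rewrite sumrB; congr (_ - _).
  rewrite uN [RHS]big_ord_recr [X in _ = X + _]big_ord_recr /= !bin_small //.
  rewrite !(mulr0, mul0r) !addr0 mulr_sumr.
  apply: eq_bigr => k _.
  have -> : (N.+2 - k = (N - k).+2)%N by have := ltn_ord k; lia.
  by rewrite !exprS; ring.
rewrite uN [RHS]big_ord_recl [X in _ + X]big_ord_recl /= !(mulr0, mul0r) !add0r.
by apply: eq_bigr => k _ /=; rewrite /bump /= !subSS !exprS; ring.
Qed.

(** With N = 2m - 1, the symmetry of the binomials exchanges the two terms of [dcoef]: N + 2 - k is
    paired with k - 2, and N - k with k. *)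
Lemma dcoef_sym m k : (0 < m)%N -> (k <= m)%N ->
  dcoef (2 * m - 1) (2 * m + 1 - k) = - dcoef (2 * m - 1) k.
Proof.
move=> m0 km; rewrite /dcoef.
have -> : (2 * m + 1 - k = (2 * m - 1 - k).+2)%N by lia.
rewrite /= bin_sub; last by lia.
case: k km => [|[|k]] km /=.
- by rewrite bin_small //; lia.
- by rewrite bin_small //; lia.
rewrite -(bin_sub (n := 2 * m - 1) (m := k)); last by lia.
have -> : (2 * m - 1 - k.+2).+2 = (2 * m - 1 - k)%N by lia.
by ring.
Qed.

(** The invariance of g under x -> 1/x, for u = x^2: the 2m + 2 terms of [dcoef_gen] are folded into
    pairs k, 2m + 1 - k. *)
Lemma dcoef_gen_half (R : comNzRingType) (u : R) m : (0 < m)%N ->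
  (1 - u ^+ 2) * (1 - u) ^+ (2 * m - 1) = \sum_(k < m.+1)
    (-1) ^+ k * (dcoef (2 * m - 1) k)%:~R * (u ^+ k + u ^+ (2 * m + 1 - k)).
Proof.
move=> m0.
have -> : (1 - u ^+ 2) * (1 - u) ^+ (2 * m - 1)
    = (u - 1) ^+ (2 * m - 1) * (u ^+ 2 - 1).
  rewrite -(opprB u 1) [in LHS]exprNn -signr_odd.
  have -> : odd (2 * m - 1) by lia.
  by rewrite expr1; ring.
rewrite dcoef_gen.
have e : ((2 * m - 1).+3 = m.+1 + m.+1)%N by lia.
rewrite -(big_mkord xpredT (fun k => (-1) ^+ k * (dcoef (2 * m - 1) k)%:~R
  * u ^+ ((2 * m - 1).+2 - k))) e big_mkord big_split_ord /= addrC.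
rewrite (reindex_inj rev_ord_inj) -big_split /=; apply: eq_bigr => k _.
have lk := ltn_ord k.
have -> : (m.+1 + (m.+1 - k.+1) = 2 * m + 1 - k)%N by lia.
rewrite dcoef_sym //.
have -> : ((2 * m - 1).+2 = 2 * m + 1)%N by lia.
have -> : (2 * m + 1 - (2 * m + 1 - k) = k)%N by lia.
have -> : (-1) ^+ (2 * m + 1 - k) = - (-1) ^+ k :> R.
  rewrite -signr_odd -[in RHS]signr_odd.
  have -> : odd (2 * m + 1 - k) = ~~ odd k by lia.
  by case: (odd k); rewrite /=; ring.
by rewrite rmorphN /=; ring.
Qed.

Lemma sum_dcoef m : (0 < m)%N ->
  \sum_(k < m.+1) (-1) ^+ k * dcoef (2 * m - 1) k = 0.
Proof.
move=> m0; have := @dcoef_gen_half int 1 m m0.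
rewrite expr1n subrr mul0r; under eq_bigr => k _ do rewrite !expr1n intz.
by rewrite -mulr_suml => /esym/eqP; rewrite mulf_eq0 orbF => /eqP.
Qed.

Lemma sum_triangle (V : nmodType) m (f : nat -> nat -> V) :
  \sum_(k < m.+1) \sum_(p < (m - k).+1) f k p
  = \sum_(s < m.+1) \sum_(k < s.+1) f k (m - s)%N.
Proof.
transitivity (\sum_(k < m.+1) \sum_(s < m.+1 | (k <= s)%N) f k (m - s)%N).
  apply: eq_bigr => k _.
  rewrite (big_ord_widen m.+1 (f k)); last by rewrite ltnS leq_subr.
  rewrite (reindex_inj rev_ord_inj) /=; apply: eq_big => [s|s _].
    by have := ltn_ord s; have := ltn_ord k; lia.
  by rewrite subSS.
rewrite (exchange_big_dep xpredT) //=; apply: eq_bigr => s _.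
by rewrite (big_ord_widen m.+1 (fun k => f k (m - s)%N)).
Qed.

Section Faulhaber.
Context {F : fieldType} (t : F) (m : nat).
Hypotheses (m0 : (0 < m)%N) (t0 : t != 0).
Hypothesis t1 : forall k, (0 < k)%N -> 1 - t ^+ k != 0.

(** [Qms] without its prefactor and, up to (-1)^s, the coefficient of W_n^(m-s) in [psumE]. *)
Definition ecoef s : F := \sum_(k < s.+1)
  (-1) ^+ (s - k) * (dcoef (2 * m - 1) k)%:~R / (1 - t ^+ (2 * (m - k) + 1))
   * acoef t (m - s) (s - k).

Definition psum n : F := \sum_(1 <= k < n.+1)
  (1 - t ^+ (4 * k)) * (1 - t ^+ (2 * k)) ^+ (2 * m - 1)
   * t ^+ ((2 * m + 1) * (n - k)).

Definition wval n : F :=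
  (1 - t ^+ (2 * n)) * (1 - t ^+ (2 * n + 2)) / t ^+ (2 * n).

Lemma psum_recr n : psum n.+1 = t ^+ (2 * m + 1) * psum n
  + (1 - t ^+ (4 * n.+1)) * (1 - t ^+ (2 * n.+1)) ^+ (2 * m - 1).
Proof.
rewrite /psum big_nat_recr //= subnn muln0 mulr1; congr (_ + _).
rewrite mulr_sumr; apply: eq_big_nat => k /andP[_ kn].
by rewrite subSn // mulnS exprD; ring.
Qed.

Lemma psum_geometric n : psum n = \sum_(k < m.+1)
  (-1) ^+ k * (dcoef (2 * m - 1) k)%:~R * t ^+ (2 * k * n)
   * (1 - t ^+ ((2 * n + 1) * (2 * (m - k) + 1)))
   / (1 - t ^+ (2 * (m - k) + 1)).
Proof.
elim: n => [|n IH].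
  (* At n = 0 every quotient is 1, so the right side is the alternating sum of [dcoef], which
     vanishes. *)
  rewrite /psum big_geq //; transitivity ((\sum_(k < m.+1)
    (-1) ^+ k * dcoef (2 * m - 1) k)%:~R : F); first by rewrite sum_dcoef.
  rewrite rmorph_sum; apply: eq_bigr => k _.
  rewrite muln0 mulr1 mul1n -mulrA divff ?mulr1; last by apply: t1; lia.
  by rewrite rmorphM rmorphXn rmorphN1.
rewrite psum_recr IH.
have -> : (4 * n.+1 = 2 * n.+1 * 2)%N by lia.
rewrite (exprM t (2 * n.+1) 2) dcoef_gen_half //.
rewrite mulr_sumr -big_split /=; apply: eq_bigr => k _.
have lk := ltn_ord k.
have nz : 1 - t ^+ (2 * (m - k) + 1) != 0 by apply: t1; lia.
have -> : (2 * m + 1 - k = k + (2 * (m - k) + 1))%N by lia.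
have -> : (2 * m + 1 = 2 * k + (2 * (m - k) + 1))%N by lia.
(* With r abstract, all exponents are sums of 2kn, 2k, 2nr and r, and the goal is a rational
   identity in these four powers of t. *)
move: (2 * (m - k) + 1)%N nz => r nz.
rewrite -!exprM.
have -> : (2 * n.+1 * (k + r) = 2 * k * n + 2 * k + 2 * n * r + r + r)%N by lia.
have -> : (2 * k * n.+1 = 2 * k * n + 2 * k)%N by lia.
have -> : (2 * n.+1 * k = 2 * k * n + 2 * k)%N by lia.
have -> : ((2 * n + 1) * r = 2 * n * r + r)%N by lia.
have -> : ((2 * n.+1 + 1) * r = 2 * n * r + r + r + r)%N by lia.
by rewrite !exprD; field.
Qed.

Lemma psumE n : psum n = t ^+ (2 * m * n) * (1 - t ^+ (2 * n + 1))
  * \sum_(s < m.+1) (-1) ^+ s * ecoef s * wval n ^+ (m - s).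
Proof.
set z := t ^+ (2 * n + 1).
have z0 : z != 0 by rewrite expf_neq0.
(* The form of W_n that [asum_geometric] expects, with z = Z = t^(2n+1). *)
have wE : wval n = t * (z + z^-1) - t ^+ 2 - 1.
  have tn0 : t ^+ (2 * n) != 0 by rewrite expf_neq0.
  rewrite /wval /z (exprD t (2 * n) 2) (exprD t (2 * n) 1) expr1.
  move: (t ^+ (2 * n)) tn0 => a a0.
  by field; rewrite t0 a0.
transitivity (t ^+ (2 * m * n) * (1 - z) * \sum_(k < m.+1)
    \sum_(p < (m - k).+1) (-1) ^+ k * (dcoef (2 * m - 1) k)%:~R
     / (1 - t ^+ (2 * (m - k) + 1)) * acoef t p (m - k - p) * wval n ^+ p).
  rewrite psum_geometric mulr_sumr; apply: eq_bigr => k _.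
  have lk := ltn_ord k.
  have nz : 1 - t ^+ (2 * (m - k) + 1) != 0 by apply: t1; lia.
  under eq_bigr => p _ do rewrite -mulrA.
  rewrite -mulr_sumr -/(asum t (wval n) (m - k)) wE.
  have H := asum_geometric F t z (m - k) z0.
  have tz : t ^+ (2 * k * n) * z ^+ (m - k) = t ^+ (m - k) * t ^+ (2 * m * n).
    by rewrite /z -exprM -!exprD; congr (_ ^+ _); nia.
  have tM : t ^+ (m - k) != 0 by rewrite expf_neq0.
  rewrite [t ^+ ((2 * n + 1) * _)]exprM -/z.
  apply: (mulfI tM).
  transitivity ((-1) ^+ k * (dcoef (2 * m - 1) k)%:~R * t ^+ (2 * k * n)
    * (t ^+ (m - k) * (1 - z ^+ (2 * (m - k) + 1)))
     / (1 - t ^+ (2 * (m - k) + 1))); first by field.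
  rewrite -H; set A := asum _ _ _.
  transitivity ((-1) ^+ k * (dcoef (2 * m - 1) k)%:~R * A * (1 - z)
    * (t ^+ (2 * k * n) * z ^+ (m - k)) / (1 - t ^+ (2 * (m - k) + 1))).
    by field.
  by rewrite tz; field.
(* Collect by powers of W_n: p = m - s. *)
rewrite (sum_triangle _ m (fun k p => (-1) ^+ k * (dcoef (2 * m - 1) k)%:~R
     / (1 - t ^+ (2 * (m - k) + 1)) * acoef t p (m - k - p) * wval n ^+ p)).
congr (_ * _); apply: eq_bigr => s _; have ls := ltn_ord s.
rewrite /ecoef mulr_sumr mulr_suml; apply: eq_bigr => k _.
have lk := ltn_ord k.
have -> : (m - k - (m - s) = s - k)%N by lia.
have -> : (-1) ^+ k = (-1) ^+ s * (-1) ^+ (s - k) :> F.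
  rewrite -exprD -signr_odd -[in RHS]signr_odd; congr (_ ^+ nat_of_bool _).
  by lia.
by ring.
Qed.

End Faulhaber.

(** * Translation to the formulas of the statement *)

Lemma binzE (a b : nat) : binz a%:Z b%:Z = 'C(a, b)%:Z.
Proof. by []. Qed.

Lemma dcoefE N k : binz N%:Z k%:Z - binz N%:Z (k%:Z - 2) = dcoef N k.
Proof.
rewrite binzE; congr (_ - _); case: k => [|[|k]] //=.
by have -> : k.+2%:Z - 2 = k%:Z by lia.
Qed.

Lemma acoef_bin (F : fieldType) (t : F) p j :
  acoef t p j = \sum_(i < j.+1) 'C(p + i, i)%:R *
    ('C(p + (j - i), j - i)%:R * t ^+ (2 * (j - i))
     + t * shift (fun l => 'C(p + l, l)%:R * t ^+ (2 * l)) (j - i)%N).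
Proof.
rewrite /acoef /bcoef -conv_shiftr mulr_sumr -big_split.
apply: eq_bigr => i _ /=; rewrite /hcoef /= expr1n mulr1 -exprM.
rewrite (shift_ext _ (fun l => 'C(p + l, l)%:R * t ^+ (2 * l))).
  by ring.
by move=> l; rewrite /hcoef /= -exprM.
Qed.

Lemma QmsE (F : fieldType) (t : F) m s : (0 < m)%N -> (s <= m)%N ->
  Qms m s t = (\prod_(j < s.+1) (1 - t ^+ (2 * m - 2 * j + 1)))
    / ((1 - t) ^+ s * (1 - t ^+ 2) ^+ (2 * s)) * ecoef t m s.
Proof.
move=> m0 sm; rewrite /Qms big_mkord; congr (_ / _ * _).
  apply: eq_bigr => j _; have lj := ltn_ord j.
  by have -> : 2 * m%:Z - 2 * j%:Z + 1 = (2 * m - 2 * j + 1)%N%:Z by lia.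
rewrite big_mkord; apply: eq_bigr => k _; have lk := ltn_ord k.
have -> : s%:Z - k%:Z = (s - k)%N%:Z by lia.
have -> : 2 * m%:Z - 2 * k%:Z + 1 = (2 * (m - k) + 1)%N%:Z by lia.
have -> : 2 * m%:Z - 1 = (2 * m - 1)%N%:Z by lia.
rewrite dcoefE -!exprnP big_mkord acoef_bin (mulrAC _ _ (_%:~R)); congr (_ * _).
apply: eq_bigr => i _; have li := ltn_ord i.
have -> : m%:Z - s%:Z + i%:Z = (m - s + i)%N%:Z by lia.
have -> : m%:Z - k%:Z - i%:Z = (m - s + (s - k - i))%N%:Z by lia.
have -> : (s - k)%N%:Z - i%:Z = (s - k - i)%N%:Z by lia.
have -> : 2 * s%:Z - 2 * k%:Z - 2 * i%:Z = (2 * (s - k - i))%N%:Z by lia.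
rewrite !binzE -!exprnP; congr (_ * (_ + _)).
(* At i = s - k the power of t has exponent -1, but its binomial has lower index -1 and is 0. *)
case: (s - k - i)%N => [|l] /=; first by rewrite mul0r mulr0.
have -> : (m - s + l.+1)%N%:Z - 1 = (m - s + l)%N%:Z by lia.
have -> : l.+1%:Z - 1 = l%:Z by lia.
have -> : (2 * l.+1)%N%:Z - 1 = (2 * l).+1%:Z by lia.
by rewrite binzE -exprnP exprS; ring.
Qed.

Section ClosedForm.
Variables (F : fieldType) (t : F) (m : nat).
Hypotheses (m0 : (0 < m)%N) (t0 : t != 0).
Hypothesis t1 : forall k, (0 < k)%N -> 1 - t ^+ k != 0.

Lemma Smn_psum n :
  Smn (2 * m) n t = psum t m n / ((1 - t ^+ 4) * (1 - t ^+ 2) ^+ (2 * m - 1)).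
Proof.
rewrite /psum mulr_suml; apply: eq_bigr => k _.
have n4 := t1 4 isT; have n2 := t1 2 isT.
rewrite expr_div_n; have := expf_neq0 (2 * m - 1) n2.
by move=> n2'; field; rewrite n2' n4.
Qed.

Lemma Smn_rhs12 n : Smn (2 * m) n t = rhs12 m n t.
Proof.
have n4 := t1 4 isT; have n2 := t1 2 isT; have n1 : 1 - t != 0 := t1 1 isT.
rewrite Smn_psum psumE // /rhs12 big_mkord mulr_sumr mulr_suml.
apply: eq_bigr => s _; have ls := ltn_ord s.
rewrite QmsE // big_mkord.
set P := \prod_(_ < _) _.
have P0 : P != 0 by apply/prodf_neq0 => i _; apply: t1; rewrite addn1.
(* This exponent is -1 for s = m, so it is split as a difference of two naturals. *)
have -> : 2 * m%:Z - 2 * s%:Z - 1 = (2 * m - 1)%N%:Z - (2 * s)%N%:Z by lia.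
rewrite expfzDr // -exprnN -exprnP /wval expr_div_n exprMn -exprM.
have -> : t ^+ (2 * m * n) = t ^+ (2 * s * n) * t ^+ (2 * n * (m - s)).
  by rewrite -exprD; congr (_ ^+ _); nia.
have := expf_neq0 (2 * n * (m - s)) t0.
have := expf_neq0 (2 * m - 1) n2.
have := expf_neq0 (2 * s) n2.
have := expf_neq0 s n1.
move: (ecoef _ _ _) => e.
move: (t ^+ (2 * s * n)) (t ^+ (2 * n * (m - s))) => u v.
move: ((1 - t ^+ 2) ^+ (2 * m - 1)) ((1 - t ^+ 2) ^+ (2 * s)) => x y.
move: ((1 - t) ^+ s) ((1 - t ^+ 4)) n4 => c d d0 c0 y0 x0 v0.
by field; rewrite ?P0 ?d0 ?c0 ?y0 ?x0 ?v0.
Qed.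

End ClosedForm.

(** * Integrality *)

(** Newton interpolation over a subring [A]: dividing p - p(v_n) by X - v_n leaves a quotient whose
    values at the other points are divided differences, hence in [A], and induction applies to
    it. *)
Lemma interp_coef (F : fieldType) (A : F -> Prop) :
  (forall x y, A x -> A y -> A (x + y)) ->
  (forall x y, A x -> A y -> A (x * y)) -> A (-1) ->
  forall (n : nat) (v : nat -> F),
  (forall i, (i < n)%N -> A (v i)) ->
  (forall i j, (j < i < n)%N -> v i != v j /\ A (v i - v j)^-1) ->
  forall p : {poly F}, (size p <= n)%N ->
  (forall i, (i < n)%N -> A p.[v i]) -> forall j, A p`_j.
Proof.
move=> AD AM AN1.
have AB x y : A x -> A y -> A (x - y).
  by move=> Ax Ay; rewrite -mulN1r; apply/AD/AM.
have A0 : A 0 by rewrite -(subrr (-1)); apply: AB.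
elim=> [|n IH] v Av vV p sp Ap j.
  by move: sp; rewrite leqn0 size_poly_eq0 => /eqP ->; rewrite coef0.
have Ac : A p.[v n] by apply: Ap.
have /factor_theorem[q Dq] : root (p - (p.[v n])%:P) (v n).
  by rewrite /root hornerD hornerN hornerC subrr.
have Dp : p = q * ('X - (v n)%:P) + (p.[v n])%:P by rewrite -Dq subrK.
have sq : (size q <= n)%N.
  have [->|q0] := eqVneq q 0; first by rewrite size_poly0.
  have := size_Mmonic q0 (monicXsubC (v n)).
  rewrite size_XsubC addn2 -Dq /= -ltnS => <-.
  apply: leq_trans (size_polyD _ _) _; rewrite geq_max sp size_polyN.
  exact: leq_trans (size_polyC_leq1 _) _.
have Aq i : A q`_i.
  apply: (IH v) => // [k kn|k l|k kn]; first by apply: Av; rewrite ltnW.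
    by move=> /andP[lk kn]; apply: vV; rewrite lk ltnW.
  have [vnk AV] : v n != v k /\ A (v n - v k)^-1 by apply: vV; rewrite kn leqnn.
  have -> : q.[v k] = (p.[v n] - p.[v k]) * (v n - v k)^-1.
    rewrite {2}Dp hornerD hornerM hornerXsubC hornerC; field.
    by rewrite subr_eq0.
  by apply/AM => //; apply: AB => //; apply: Ap; rewrite ltnW.
move: (p.[v n]) Ac Dp => c Ac ->.
rewrite coefD mulrBr coefB coefMX coefMC coefC.
apply: AD; last by case: ifP.
by apply: AB; [case: ifP | apply: AM; [apply: Aq | apply: Av]].
Qed.

(** At each step a is a root of p d but not of d, so the factor theorem takes one X - a out of p. *)
Lemma XsubC_exp_dvd (R : idomainType) (a : R) k (p d r : {poly R}) :
  d.[a] != 0 -> p * d = r * ('X - a%:P) ^+ k ->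
  exists p', p = p' * ('X - a%:P) ^+ k.
Proof.
move=> da; elim: k p r => [|k IH] p r Dp; first by exists p; rewrite mulr1.
have /factor_theorem[p1 Dp1] : root p a.
  have := congr1 (horner^~ a) Dp; rewrite /= !hornerM exprS hornerM hornerXsubC.
  rewrite subrr mul0r mulr0 => /eqP.
  rewrite mulf_eq0 (negPf da) orbF => /eqP pa.
  by rewrite /root pa.
have [|p2 Dp2] := IH p1 r; last by exists p2; rewrite Dp1 Dp2 exprSr mulrA.
have X0 : 'X - a%:P != 0 by rewrite polyXsubC_eq0.
apply: (mulIf X0); rewrite mulrAC -Dp1 Dp exprSr; ring.
Qed.

(** * Regularity at 1 and -1, in a field containing Z[t] through [iota] *)

Section Integrality.
Variables (F : fieldType) (iota : {rmorphism {poly int} -> F}).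
Hypothesis iota_inj : injective iota.

Local Notation t := (iota 'X).

Lemma iota_eq0 p : (iota p == 0) = (p == 0).
Proof. by rewrite -(rmorph0 iota) (inj_eq iota_inj). Qed.

(** A localization of Z[t] in which nonzero integers are invertible; integrality over Z is recovered
    only in [Qms_integral]. *)
Definition regular (x : F) := exists p d : {poly int},
  [/\ d.[1] != 0, d.[-1] != 0 & x * iota d = iota p].

Lemma regularP p : regular (iota p).
Proof. by exists p, 1; split; rewrite ?hornerC ?rmorph1 ?mulr1. Qed.

Lemma regularD x y : regular x -> regular y -> regular (x + y).
Proof.
move=> [p [d [d1 dN xE]]] [p' [d' [d1' dN' yE]]].
exists (p * d' + p' * d), (d * d'); split; rewrite ?hornerM ?mulf_neq0 //.
by rewrite rmorphD !rmorphM /= -xE -yE; ring.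
Qed.

Lemma regularM x y : regular x -> regular y -> regular (x * y).
Proof.
move=> [p [d [d1 dN xE]]] [p' [d' [d1' dN' yE]]].
exists (p * p'), (d * d'); split; rewrite ?hornerM ?mulf_neq0 //.
by rewrite !rmorphM /= -xE -yE; ring.
Qed.

Lemma regularV (d : {poly int}) :
  d.[1] != 0 -> d.[-1] != 0 -> regular (iota d)^-1.
Proof.
move=> d1 dN; exists 1, d; split=> //; rewrite rmorph1 mulVf //.
by rewrite iota_eq0; apply: contraNneq d1 => ->; rewrite horner0.
Qed.

Definition is_poly (x : F) := exists p : {poly int}, x = iota p.

Lemma is_polyD x y : is_poly x -> is_poly y -> is_poly (x + y).
Proof. by move=> [p ->] [q ->]; exists (p + q); rewrite rmorphD. Qed.

Lemma is_polyM x y : is_poly x -> is_poly y -> is_poly (x * y).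
Proof. by move=> [p ->] [q ->]; exists (p * q); rewrite rmorphM. Qed.

Lemma t_neq0 : t != 0.
Proof. by rewrite iota_eq0 polyX_eq0. Qed.

Lemma subr_expt_neq0 k : (0 < k)%N -> 1 - t ^+ k != 0.
Proof.
move=> k0; rewrite -rmorphXn -(rmorph1 iota) -rmorphB /=.
rewrite iota_eq0 -oppr_eq0 opprB.
apply/eqP => /(congr1 (fun p : {poly int} => p`_k)).
by rewrite coefB coefXn eqxx coef1 coef0 (gtn_eqF k0).
Qed.

Definition geom (c k : nat) : {poly int} := \sum_(i < k) 'X^(c * i).

Lemma geomE c k : 1 - t ^+ (c * k) = (1 - t ^+ c) * iota (geom c k).
Proof.
rewrite -!rmorphXn -(rmorph1 iota) -!rmorphB -rmorphM /=.
congr (iota _); rewrite exprM -opprB subrX1 -mulNr opprB; congr (_ * _).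
by apply: eq_bigr => i _; rewrite exprM.
Qed.

Lemma geom_1 c k : (0 < k)%N -> (geom c k).[1] != 0.
Proof.
move=> k0; rewrite horner_sum; under eq_bigr do rewrite hornerXn expr1n.
by rewrite sumr_const card_ord; lia.
Qed.

Lemma geom_N1 c k : ~~ odd c || odd k -> (0 < k)%N -> (geom c k).[-1] != 0.
Proof.
move=> ck k0; rewrite horner_sum.
under eq_bigr do rewrite hornerXn exprM -signr_odd.
case: (boolP (odd c)) ck => /= [_ ok|_ _]; last first.
  under eq_bigr do rewrite expr1n.
  by rewrite sumr_const card_ord; lia.
(* For c and k odd, (-1)^k - 1 = -2 is a multiple of the sum, which is therefore nonzero. *)
apply/eqP => S0; have := subrX1 (-1 : int) k.
by rewrite S0 mulr0 -signr_odd ok.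
Qed.

Lemma is_polyX k : is_poly (t ^+ k).
Proof. by exists 'X^k; rewrite rmorphXn. Qed.

Lemma is_poly_int (z : int) : is_poly z%:~R.
Proof. by exists z%:~R; rewrite rmorph_int. Qed.

Lemma is_poly_nat (n : nat) : is_poly n%:R.
Proof. exact: (is_poly_int n). Qed.

Lemma is_poly_sum n (f : 'I_n -> F) :
  (forall i, is_poly (f i)) -> is_poly (\sum_(i < n) f i).
Proof.
move=> fP; apply: big_ind => //; last exact: is_polyD.
exact: (is_poly_int 0).
Qed.

Lemma is_poly_prod n (P : pred 'I_n) (f : 'I_n -> F) :
  (forall i, is_poly (f i)) -> is_poly (\prod_(i < n | P i) f i).
Proof.
move=> fP; apply: big_ind => //; last exact: is_polyM.
exact: (is_poly_int 1).
Qed.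

Lemma is_poly_1BX k : is_poly (1 - t ^+ k).
Proof. by exists (1 - 'X^k); rewrite rmorphB rmorph1 rmorphXn. Qed.

Lemma is_poly_regular x : is_poly x -> regular x.
Proof. by move=> [p ->]; apply: regularP. Qed.

Lemma is_poly_acoef p j : is_poly (acoef t p j).
Proof.
rewrite acoef_bin; apply: is_poly_sum => i.
apply: is_polyM; first exact: is_poly_nat.
apply: is_polyD.
  by apply: is_polyM; [apply: is_poly_nat | apply: is_polyX].
apply: is_polyM; first exact: (is_polyX 1).
case: (j - i)%N => [|l] /=; first exact: (is_poly_int 0).
by apply: is_polyM; [apply: is_poly_nat | apply: is_polyX].
Qed.

(** The denominator of the k-th term of [ecoef] is the factor j = k of the product. *)
Lemma is_poly_prod_ecoef m s : (s <= m)%N ->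
  is_poly ((\prod_(j < s.+1) (1 - t ^+ (2 * m - 2 * j + 1))) * ecoef t m s).
Proof.
move=> sm; rewrite /ecoef mulr_sumr; apply: is_poly_sum => k.
have lk := ltn_ord k.
rewrite (bigD1 k) //= -mulnBr.
have nz : 1 - t ^+ (2 * (m - k) + 1) != 0.
  by apply: subr_expt_neq0; rewrite addn1.
set P := \prod_(_ < _ | _) _; set c := _ ^+ (s - k); set d := _%:~R.
have -> : (1 - t ^+ (2 * (m - k) + 1)) * P
    * (c * d / (1 - t ^+ (2 * (m - k) + 1)) * acoef t (m - s) (s - k))
    = P * (c * d) * acoef t (m - s) (s - k) by field.
apply: is_polyM; last exact: is_poly_acoef.
apply: is_polyM; first by apply: is_poly_prod => i; apply: is_poly_1BX.
apply: is_polyM; last exact: is_poly_int.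
have -> : c = ((-1) ^+ (s - k))%:~R by rewrite rmorphXn rmorphN1.
exact: is_poly_int.
Qed.

(** Each summand is divisible by (1 - t^2)^(2m): one factor comes from 1 - t^(4k), the others from
    (1 - t^(2k))^(2m-1). *)
Lemma regular_psum m n : (0 < m)%N ->
  regular (psum t m n / (1 - t ^+ 2) ^+ (2 * m)).
Proof.
move=> m0; apply: is_poly_regular.
rewrite /psum big_add1 big_mkord mulr_suml; apply: is_poly_sum => k.
have -> : (4 * k.+1 = 2 * (2 * k.+1))%N by lia.
rewrite !geomE; set g := iota (geom _ _); set h := iota (geom _ _).
have -> : (2 * m = (2 * m - 1).+1)%N by lia.
rewrite subSS subn0 exprMn; set u := 1 - t ^+ 2.
have u0 : u != 0 by apply: subr_expt_neq0.
have u1 : u ^+ (2 * m - 1) != 0 by rewrite expf_neq0.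
have -> : u * g * (u ^+ (2 * m - 1) * h ^+ (2 * m - 1)) *
    t ^+ (((2 * m - 1).+1 + 1) * (n - k.+1)) / u ^+ (2 * m - 1).+1
   = g * h ^+ (2 * m - 1) * t ^+ (((2 * m - 1).+1 + 1) * (n - k.+1)).
  by rewrite exprS; field; rewrite u0 u1.
apply: is_polyM; last exact: is_polyX.
apply: is_polyM; first by exists (geom 2 (2 * k.+1)).
by exists (geom 2 k.+1 ^+ (2 * m - 1)); rewrite rmorphXn.
Qed.

Definition vval n : F := wval t n / (1 - t ^+ 2) ^+ 2.

Lemma regular_tV k : regular (t ^+ k)^-1.
Proof.
rewrite -rmorphXn; apply: regularV; rewrite hornerXn ?expr1n //.
by rewrite expf_neq0.
Qed.

Lemma vvalE n : vval n = iota (geom 2 n * geom 2 n.+1) / t ^+ (2 * n).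
Proof.
have u0 : 1 - t ^+ 2 != 0 by apply: subr_expt_neq0.
have x0 : t ^+ (2 * n) != 0 by rewrite expf_neq0 ?t_neq0.
rewrite /vval /wval; have -> : (2 * n + 2 = 2 * n.+1)%N by lia.
by rewrite !geomE rmorphM /=; field; rewrite u0 x0.
Qed.

(** Z + 1/Z - Z' - 1/Z' = (Z - Z')(1 - 1/(ZZ')), so the difference of two points is, up to a power
    of t, a product of [geom] values nonzero at 1 and -1. *)
Lemma vvalB i j : (j < i)%N ->
  vval i - vval j = iota (geom 2 (i - j) * geom 2 (i + j).+1) / t ^+ (2 * i).
Proof.
move=> ji.
have u0 : 1 - t ^+ 2 != 0 by apply: subr_expt_neq0.
have x0 : t ^+ (2 * j) != 0 by rewrite expf_neq0 ?t_neq0.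
have y0 : t ^+ (2 * (i - j)) != 0 by rewrite expf_neq0 ?t_neq0.
have u20 : (1 - t ^+ 2) ^+ 2 != 0 by rewrite expf_neq0.
apply: (mulIf u20).
transitivity ((1 - t ^+ (2 * (i - j))) * (1 - t ^+ (2 * (i + j).+1))
   / t ^+ (2 * i)); last by rewrite !geomE rmorphM /=; ring.
rewrite /vval mulrBl !divfK // /wval.
have e : (2 * i = 2 * j + 2 * (i - j))%N by lia.
have -> : (2 * (i + j).+1 = 2 * i + 2 * j + 2)%N by lia.
rewrite e (exprD _ (2 * j + 2 * (i - j) + 2 * j) 2).
rewrite (exprD _ (2 * j + 2 * (i - j)) 2) (exprD _ (2 * j) 2).
rewrite (exprD _ (2 * j + 2 * (i - j)) (2 * j)) (exprD _ (2 * j) (2 * (i - j))).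
move: (t ^+ (2 * j)) (t ^+ (2 * (i - j))) x0 y0 => a b a0 b0.
by field; rewrite a0 b0.
Qed.

Lemma regular_ecoef m s : (0 < m)%N -> (s <= m)%N ->
  regular ((-1) ^+ s * (1 - t) * ecoef t m s / (1 - t ^+ 2) ^+ (2 * s)).
Proof.
move=> m0 sm.
pose G s := (-1) ^+ s * (1 - t) * ecoef t m s / (1 - t ^+ 2) ^+ (2 * s).
(* The sum in [psumE] as a polynomial in [vval n]: dividing it by (1 - t^2)^(2m) leaves (1 -
   t^2)^(2s) under the coefficient of degree m - s. The factor 1 - t makes the values regular, since
   (1 - t^(2n+1)) / (1 - t) is a [geom]. *)
pose p := \poly_(j < m.+1) G (m - j)%N.
have -> : (-1) ^+ s * (1 - t) * ecoef t m s / (1 - t ^+ 2) ^+ (2 * s)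
    = p`_(m - s).
  by rewrite coef_poly ltnS leq_subr subKn.
have u0 : 1 - t ^+ 2 != 0 by apply: subr_expt_neq0.
apply: (interp_coef F regular regularD regularM _ m.+1 vval).
- exact: is_poly_regular (is_poly_int (-1)).
- move=> i _; rewrite vvalE; apply: regularM; first exact: regularP.
  exact: regular_tV.
- move=> i j /andP[ji im].
  have g1 : (geom 2 (i - j) * geom 2 (i + j).+1).[1] != 0.
    by rewrite hornerM mulf_neq0 // geom_1 // subn_gt0.
  have gN1 : (geom 2 (i - j) * geom 2 (i + j).+1).[-1] != 0.
    by rewrite hornerM mulf_neq0 // geom_N1 // subn_gt0.
  have g0 : iota (geom 2 (i - j) * geom 2 (i + j).+1) != 0.
    by rewrite iota_eq0; apply: contraNneq g1 => ->; rewrite horner0.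
  rewrite -subr_eq0 vvalB //; split.
    by rewrite mulf_neq0 // invr_eq0 expf_neq0 ?t_neq0.
  rewrite invf_div; apply: regularM; first exact/is_poly_regular/is_polyX.
  exact: regularV.
- exact: size_poly.
move=> n _; rewrite horner_poly (reindex_inj rev_ord_inj) /=.
have -> : \sum_(i < m.+1) G (m - (m.+1 - i.+1))%N * vval n ^+ (m.+1 - i.+1)
  = (psum t m n / (1 - t ^+ 2) ^+ (2 * m))
     * ((t ^+ (2 * m * n))^-1 * (iota (geom 1 (2 * n + 1)))^-1).
  have g0 : iota (geom 1 (2 * n + 1)) != 0.
    rewrite iota_eq0; have : (geom 1 (2 * n + 1)).[1] != 0.
      by rewrite geom_1 // addn1.
    by apply: contraNneq => ->; rewrite horner0.
  have x0 : t ^+ (2 * m * n) != 0 by rewrite expf_neq0 ?t_neq0.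
  rewrite psumE //; [|exact: t_neq0|exact: subr_expt_neq0].
  have := geomE 1 (2 * n + 1); rewrite mul1n expr1 => ->.
  have U0 : (1 - t ^+ 2) ^+ (2 * m) != 0 by rewrite expf_neq0.
  set g := iota (geom _ _); set S := (X in _ = _ * X / _ * _).
  transitivity ((1 - t) / (1 - t ^+ 2) ^+ (2 * m) * S); last first.
    by field; rewrite x0 g0 U0.
  rewrite mulr_sumr; apply: eq_bigr => i _; have li := ltn_ord i.
  rewrite subSS subKn -1?ltnS // /G /vval expr_div_n -exprM.
  have -> : (2 * m = 2 * i + 2 * (m - i))%N by lia.
  rewrite exprD.
  have A0 : (1 - t ^+ 2) ^+ (2 * i) != 0 by rewrite expf_neq0.
  have B0 : (1 - t ^+ 2) ^+ (2 * (m - i)) != 0 by rewrite expf_neq0.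
  move: (_ ^+ (2 * i)) (_ ^+ (2 * (m - i))) A0 B0 => A B A0 B0.
  by field; rewrite A0 B0.
apply: regularM; first exact: regular_psum.
apply: regularM; first exact: regular_tV.
by apply: regularV; [apply: geom_1 | apply: geom_N1]; rewrite ?addn1 //=; lia.
Qed.

Lemma regular_Qms m s : (0 < m)%N -> (s <= m)%N -> regular (Qms m s t).
Proof.
move=> m0 sm; rewrite QmsE //.
set E := ecoef _ _ _.
(* Of these s + 1 factors 1 - t, s cancel against the denominator and the last one is absorbed by
   [regular_ecoef]. *)
have -> : \prod_(j < s.+1) (1 - t ^+ (2 * m - 2 * j + 1))
    = (1 - t) ^+ s.+1 * \prod_(j < s.+1) iota (geom 1 (2 * m - 2 * j + 1)).
  under eq_bigr => j _ do rewrite -[(_ + 1)%N]mul1n geomE.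
  by rewrite big_split /= prodr_const card_ord expr1.
set P := \prod_(_ < _) _.
have -> : (1 - t) ^+ s.+1 * P / ((1 - t) ^+ s * (1 - t ^+ 2) ^+ (2 * s)) * E
    = (P * (-1) ^+ s)
      * ((-1) ^+ s * (1 - t) * E / (1 - t ^+ 2) ^+ (2 * s)).
  have u0 : 1 - t != 0 := subr_expt_neq0 1 isT.
  have A0 : (1 - t) ^+ s != 0 by rewrite expf_neq0.
  have B0 : (1 - t ^+ 2) ^+ (2 * s) != 0 by rewrite expf_neq0 // subr_expt_neq0.
  have s2 : (-1) ^+ s * (-1) ^+ s = 1 :> F.
    by rewrite -signr_odd; case: odd; rewrite /=; ring.
  transitivity ((-1) ^+ s * (-1) ^+ s
    * (P * (1 - t) * E / (1 - t ^+ 2) ^+ (2 * s))).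
    by rewrite s2 exprS; field; rewrite A0 B0.
  by field.
apply: regularM; last exact: regular_ecoef.
apply: is_poly_regular; apply: is_polyM.
  by apply: is_poly_prod => j; exists (geom 1 (2 * m - 2 * j + 1)).
by exists ((-1) ^+ s); rewrite rmorphXn rmorphN1.
Qed.

(** Write Q = N/D with D = (1 - t)^s (1 - t^2)^(2s), and Q = q/d by regularity. In N d = q D the
    roots 1 and -1 of D are not roots of d, so D divides N. *)
Lemma Qms_integral m s : (0 < m)%N -> (s <= m)%N -> is_poly (Qms m s t).
Proof.
move=> m0 sm.
have [q [d [d1 dN QE]]] := regular_Qms m s m0 sm.
have [N NE] := is_poly_prod_ecoef m s sm.
have u0 : 1 - t != 0 := subr_expt_neq0 1 isT.
have A0 : (1 - t) ^+ s != 0 by rewrite expf_neq0.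
have B0 : (1 - t ^+ 2) ^+ (2 * s) != 0 by rewrite expf_neq0 // subr_expt_neq0.
have DE : (1 - t) ^+ s * (1 - t ^+ 2) ^+ (2 * s) = iota ((-1) ^+ s
    * (('X - (-1)%:P) ^+ (2 * s) * ('X - 1%:P) ^+ (3 * s))).
  rewrite -!rmorphXn -(rmorph1 iota) -!rmorphB -!rmorphXn.
  rewrite -rmorphM /=; congr (iota _); rewrite polyCN polyC1.
  transitivity (((1 - 'X) * (1 - 'X^2) ^+ 2) ^+ s : {poly int}).
    by rewrite exprMn -exprM.
  rewrite mulrA !(exprM _ _ s) -!exprMn; congr (_ ^+ _); ring.
have NQ : iota N = Qms m s t * ((1 - t) ^+ s * (1 - t ^+ 2) ^+ (2 * s)).
  by rewrite -NE QmsE //; field; rewrite A0 B0.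
have NdE : N * d = q * (-1) ^+ s * ('X - (-1)%:P) ^+ (2 * s)
    * ('X - 1%:P) ^+ (3 * s).
  apply: iota_inj; rewrite rmorphM /= NQ DE mulrAC QE -rmorphM /=.
  by rewrite !mulrA.
have [N1 DN1] := XsubC_exp_dvd _ _ _ _ _ _ d1 NdE.
have X10 : ('X - 1%:P) ^+ (3 * s) != 0 :> {poly int}.
  by rewrite expf_neq0 // polyXsubC_eq0.
have [|N2 DN2] := XsubC_exp_dvd _ (-1) (2 * s) N1 d (q * (-1) ^+ s) dN.
  by apply: (mulIf X10); rewrite -NdE DN1; ring.
(* The sign comes from D = (-1)^s (X + 1)^(2s) (X - 1)^(3s). *)
exists (N2 * (-1) ^+ s).
have D0 := mulf_neq0 A0 B0; apply: (mulIf D0); rewrite -NQ DE -rmorphM /=.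
congr (iota _); rewrite DN1 DN2.
have s2 : (-1) ^+ s * (-1) ^+ s = 1 :> {poly int}.
  by rewrite -signr_odd; case: odd; rewrite /=; ring.
by rewrite -[LHS]mulr1 -[X in _ * X = _]s2; move: ((-1) ^+ s) => e; ring.
Qed.

End Integrality.

Theorem theorem1p2 (m n : nat) : (1 <= m)%N -> (1 <= n)%N ->
  (forall s : nat, (s <= m)%N ->
     exists p : {poly int}, Qms m s tX = FracField.tofrac p)
  /\ Smn (2 * m) n tX = rhs12 m n tX.
Proof.
have tofrac_inj : injective (@FracField.tofrac {poly int}).
  by move=> p q /eqP; rewrite tofrac_eq => /eqP.
move=> m0 _; split=> [s sm|]; first exact: Qms_integral tofrac_inj m s m0 sm.
exact: Smn_rhs12 m0 (t_neq0 _ _ tofrac_inj) (subr_expt_neq0 _ _ tofrac_inj) n.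
Qed.
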